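(* Let $H$ be a separable Hilbert space and let $\Psi=\{\psi_k^\omega:H\to H,\ k\in\mathbb{Z}_+\}$ be a discrete-time random dynamical system in $H$ over a group of measure-preserving transformations $\{\sigma_k, k\in\mathbb{Z}\}$ acting on a complete probability space $(\Omega,\mathcal{F},\mathbb{P})$. Assume that there is a Hilbert space $V$ compactly embedded in $H$, a random compact set $\{\mathcal{A}_\omega\}$ in $H$, and constants $m,r>0$ such that: (Absorption) $\{\mathcal{A}_\omega\}$ is a random absorbing set for $\Psi$. (Stability) With probability $1$, $\psi_1^\omega\bigl(\mathcal{O}_r(\mathcal{A}_\omega)\bigr)\subset\mathcal{A}_{\sigma_1\omega}$. (Lipschitz continuity) There is an almost surely finite random variable $K_\omega\ge1$ such that $K^m\in L^1(\Omega,\mathbb{P})$ and $$\|\psi_1^\omega(u_1)-\psi_1^\omega(u_2)\|_V\le K_\omega\|u_1-u_2\|_H\quad\text{for }u_1,u_2\in\mathcal{O}_r(\mathcal{A}_\omega).$$ (Kolmogorov $\varepsilon$-entropy) There is a constant $C$ and an almost surely finite random variable $C_\omega$ such that $C_\omega K_\omega^m\in L^1(\Omega,\mathbb{P})$ and, for all $\varepsilon>0$, $$\mathcal{H}_\varepsilon(V,H)\le C\varepsilon^{-m},\qquad \mathcal{H}_\varepsilon(\mathcal{A}_\omega,H)\le C_\omega\varepsilon^{-m}.$$ Then $\Psi$ possesses a random exponential attractor $\mathcal{M}_\omega$. Moreover, the attraction property holds for the norm of $V$: $$d_V\bigl(\psi_k^\omega(B),\mathcal{M}_{\sigma_k\omega}\bigr)\le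 C(B)e^{-\beta k}\quad\text{for }k\ge0,$$ where $B\subset H$ is an arbitrary ball and $C(B)$ and $\beta>0$ are some constants not depending on $k$.
   Context: Conventions. A property involving the random parameter $\omega$ is understood to hold almost surely unless specified otherwise. Discrete-time random dynamical system (RDS) in $H$ over $\{\sigma_k\}$: a family of continuous mappings $\psi_k^\omega:H\to H$, $k\in\mathbb{Z}_+$, such that $(k,\omega,u)\mapsto\psi_k^\omega(u)$ is measurable and, for almost every $\omega$, $\psi_{k+l}^\omega=\psi_k^{\sigma_l\omega}\circ\psi_l^\omega$ for all $k,l\ge0$. Random compact set in $H$: a family $\{\mathcal{A}_\omega\}$ of compact subsets of $H$ such that $\omega\mapsto\inf_{v\in\mathcal{A}_\omega}\|u-v\|_H$ is measurable for any $u\in H$. It is absorbing for $\Psi$ if for any ball $B\subset H$ there is $T(B)\ge0$ such that $\psi_k^\omega(B)\subset\mathcal{A}_{\sigma_k\omega}$ for $k\ge T(B)$, $\omega\in\Omega$. $\mathcal{O}_r(A)$ is the closed $r$-neighbourhood of $A$ in $H$. $\mathcal{H}_\varepsilon(\mathcal{K},H)$ is the Kolmogorov $\varepsilon$-entropy of a compact set $\mathcal{K}\subset H$ (natural logarithm of the minimal number of balls of radius $\varepsilon$ in $H$ needed to cover $\mathcal{K}$), and $\mathcal{H}_\varepsilon(V,H)$ is the $\varepsilon$-entropy of the unit ball of $V$ considered as a subset of $H$. Distances: $d(u,F)=\inf_{v\in F}\|u-v\|$, $d(F_1,F_2)=\sup_{u\in F_1}d(u,F_2)$; the subscript $V$ means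 that the norm of $V$ is used, and no subscript means the norm of $H$. Random exponential attractor (discrete time): a random compact set $\{\mathcal{M}_\omega\}$ in $H$ for which there is $\Omega_*\in\mathcal{F}$ of full measure such that for $\omega\in\Omega_*$: $\psi_k^\omega(\mathcal{M}_\omega)\subset\mathcal{M}_{\sigma_k\omega}$ for all $k\ge0$; there is a constant $\beta>0$ such that $d(\psi_k^\omega(B),\mathcal{M}_{\sigma_k\omega})\le C(B)e^{-\beta k}$ for $k\ge0$, where $B\subset H$ is an arbitrary ball and $C(B)$ is a constant depending only on $B$; and there is a random variable $d_\omega\ge0$, finite on $\Omega_*$, such that the fractal dimension satisfies $\dim_f(\mathcal{M}_\omega)\le d_\omega$.
   Formalization: The attraction estimate is proved for k ≥ T(B), with T(B) the absorption time of the ball B, and the estimate in the norm of V for k ≥ T(B)+1, instead of k ≥ 0; for smaller k both can fail, since images of balls may be unbounded in H or not controlled in V. *)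

(* Defs.v *)
From HB Require Import structures.
From mathcomp Require Export all_boot all_order all_algebra.
From mathcomp Require Export sesquilinear.
From mathcomp Require Export all_classical all_reals all_analysis measurable_realfun.
Export Order.TTheory GRing.Theory Num.Theory.
Export numFieldNormedType.Exports.

Set Implicit Arguments.
Unset Strict Implicit.
Unset Printing Implicit Defensive.

Local Open Scope classical_set_scope.
Local Open Scope ring_scope.

(* Together with [completeNormedModType], this says that [H] is a (real)
   Hilbert space. *)
Definition hilbertian (R : realType) (H : normedModType R) : Prop :=
  exists ip : {dot H for idfun}, forall u : H, ip u u = `|u| ^+ 2.

Definition separable_space (T : topologicalType) : Prop :=
  exists D : set T, countable D /\ dense D.

Definition compact_embedding (R : realType) (V H : normedModType R)
    (iota : {linear V -> H}) : Prop :=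
  [/\ injective iota, continuous iota &
      forall B : set V, bounded_set B -> precompact (iota @` B)].

Section Distances.
Context {R : realType} {H : normedModType R}.
Local Open Scope ereal_scope.

Definition normH (u : H) : \bar R := `|u|%:E.

(* The norm of [V] transported to [H]: [`|v|] at [iota v], and [+oo] outside
   the image of [iota]. *)
Definition normV {V : normedModType R} (iota : {linear V -> H}) (w : H)
  : \bar R := ereal_inf [set `|v|%:E | v in [set v : V | iota v = w]].

(* Distances relative to an extended norm [N] on [H]. *)
Definition dist_pt (N : H -> \bar R) (u : H) (F : set H) : \bar R :=
  ereal_inf [set N (u - v)%R | v in F].

Definition dist_set (N : H -> \bar R) (F1 F2 : set H) : \bar R :=
  ereal_sup [set dist_pt N u F2 | u in F1].

Definition closed_nbhd (r : R) (A : set H) : set H :=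
  [set u | dist_pt normH u A <= r%:E].

Definition covering_number (K : set H) (e : R) : \bar R :=
  ereal_inf [set n%:R%:E | n in [set n : nat |
    exists c : nat -> H, K `<=` \bigcup_(j in `I_n) closed_ball (c j) e]].

Definition entropy (K : set H) (e : R) : \bar R := lne (covering_number K e).

Definition fractal_dim (K : set H) : \bar R :=
  limf_esup (fun e : R => entropy K e * ((ln e^-1)^-1)%:E) (0%R : R)^'+.

Definition entropy_embedding {V : normedModType R} (iota : {linear V -> H})
  (e : R) : \bar R := entropy (iota @` closed_ball (0%R : V) 1) e.

End Distances.

Definition measure_preserving_group (R : realType) (d : measure_display)
    (Omega : measurableType d) (P : probability Omega R)
    (sigma : int -> Omega -> Omega) : Prop :=
  [/\ forall omega, sigma 0 omega = omega,
      forall k l omega, sigma (k + l) omega = sigma k (sigma l omega),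
      forall k, measurable_fun [set: Omega] (sigma k) &
      forall k (E : set Omega), measurable E -> P (sigma k @^-1` E) = P E].

Definition borel (T : topologicalType) := g_sigma_algebraType (@open T).

Section RandomDynamicalSystems.
Context {R : realType} {H : normedModType R} {d : measure_display}
  {Omega : measurableType d} (P : probability Omega R)
  (sigma : int -> Omega -> Omega) (psi : nat -> Omega -> H -> H).

Definition is_rds : Prop :=
  [/\ forall k omega, continuous (psi k omega),
      measurable_fun [set: nat * Omega * borel H]
        (fun z => psi z.1.1 z.1.2 z.2 : borel H) &
      {ae P, forall omega, forall k l : nat,
        psi (k + l) omega = psi k (sigma l%:Z omega) \o psi l omega}].

Definition random_compact_set (A : Omega -> set H) : Prop :=
  (forall omega, compact (A omega)) /\
  (forall u : H,
     measurable_fun [set: Omega] (fun omega => dist_pt normH u (A omega))).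

(* [A] absorbs the ball of centre [c] and radius [rho] from time [T c rho]
   on; [T c rho] does not depend on [omega]. *)
Definition absorbing_from (T : H -> R -> nat) (A : Omega -> set H) : Prop :=
  forall (c : H) (rho : R) (k : nat) (omega : Omega), (T c rho <= k)%N ->
    psi k omega @` closed_ball c rho `<=` A (sigma k%:Z omega).

(* Exponential attraction on [S] in the extended norm [N], at rate [beta] and
   with constants depending on the ball only, each ball being considered from
   time [T] on. *)
Definition attracts_from (N : H -> \bar R) (T : H -> R -> nat)
    (S : set Omega) (M : Omega -> set H) : Prop :=
  exists beta : R, 0 < beta /\
  exists C : H -> R -> R,
    forall omega, S omega -> forall (c : H) (rho : R) (k : nat),
      (T c rho <= k)%N ->
      (dist_set N (psi k omega @` closed_ball c rho) (M (sigma k%:Z omega))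
        <= (C c rho * expR (- beta * k%:R))%R%:E)%E.

(* A map that is merely continuous on an infinite-dimensional [H] may send a
   ball to an unbounded set, which is at infinite distance from every compact
   set. Attraction of a ball is therefore measured from a time [T] after which
   its images are controlled; [T] constantly equal to [0] gives attraction at
   all times. *)
Definition random_exponential_attractor (T : H -> R -> nat)
    (M : Omega -> set H) : Prop :=
  random_compact_set M /\
  exists Omega_star : set Omega,
  [/\ measurable Omega_star /\ P Omega_star = 1%E,
      forall omega, Omega_star omega -> forall k : nat,
        psi k omega @` M omega `<=` M (sigma k%:Z omega),
      attracts_from normH T Omega_star M &
      exists dimb : Omega -> \bar R,
      [/\ measurable_fun [set: Omega] dimb,
          forall omega, (0 <= dimb omega)%E,
          forall omega, Omega_star omega -> dimb omega \is a fin_num &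
          forall omega, Omega_star omega ->
            (fractal_dim (M omega) <= dimb omega)%E]].

End RandomDynamicalSystems.

(* Main.v *)
Require Import Defs.
From mathcomp Require Import ring lra zify.

Set Implicit Arguments.
Unset Strict Implicit.
Unset Printing Implicit Defensive.

Local Open Scope classical_set_scope.
Local Open Scope ring_scope.

(** Why the theorem is true. Start from an enlargement [Z_0(w)] of [A_w] and
    push it forward from the past: [Z_n(w)] is the image of [Z_0(sigma_{-n} w)]
    under [psi_n]. By stability these sets decrease, and they absorb every ball
    after the absorption time. Smoothing makes them small in the following
    sense: if [Z_n(sigma_{-1} w)] is covered by balls of radius
    [exp(-n) r / K_{sigma_{-1} w}], then [psi_1] turns each of them into a subset
    of a translate of the [V]-ball of radius [2 exp(-n) r], and the entropy of the
    embedding says how many [H]-balls of radius [exp(-n-1) r / K_w] are needed to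
    cover it, namely [exp(const K_w^m)]. Dividing the radii by the random
    Lipschitz constant is what makes all attraction estimates uniform in [w], in
    the norm of [V] as well. Hence [Z_n(w)] is covered by [exp(S_{n+1}(w))] balls
    of radius [exp(-n) r / K_w] ([pullback_covered]), where [S_n] is the Birkhoff
    sum, along the past, of an integrable function [f] comparable to
    [C_w K_w^m + K_w^m].

    Choose a finite net of each [Z_n(w)] inside [Z_n(w)] with at most that many
    points, and let [M_w] be the closure of all forward images of these nets. It
    is invariant by construction and it attracts at rate [exp(-n)] because [Z_n]
    does. For the dimension, all but about [n^2] of the nets have their images in
    [Z_n(w)], so that [M_w] is covered by about [n^2 exp(S_{n+1}(w))] balls of
    radius [exp(-n) r / K_w] ([skeleton_covered]); the dimension is therefore at
    most a constant plus a multiple of [sup_n S_n(w)/n]. This supremum is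
    finite almost surely by the maximal inequality ([maximal_inequality],
    [birkhoff_sum_linear_growth]).

    Measurability comes for free from the choice of the nets. Their points are
    images of points of a fixed dense sequence [h], so that a net is coded by a
    finite list of integers; the net property is a countable combination of
    measurable conditions on [w], because [Z_0(w)] is open and the images of the
    points [h_i] lying in it are dense in [Z_n(w)]. Taking the net with the least
    code is then a measurable choice ([measurable_chosen_net]). *)

(** * Finite covers and entropy *)

Section Covering.
Context {R : realType} {H : normedModType R}.
Implicit Types (S : set H) (rho x y : R).

(** The number of balls is bounded by a real number, since the bounds that occur
    are exponentials of entropies. *)
Definition covered S rho x : Prop := exists s : seq H,
  (size s)%:R <= x /\ forall u, S u -> exists2 c, c \in s & `|u - c| <= rho.

Lemma covered_mono S S' rho rho' x x' : S `<=` S' -> rho' <= rho -> x' <= x ->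
  covered S' rho' x' -> covered S rho x.
Proof.
move=> SS' rr xx [s [sx sS]]; exists s; split; first exact: le_trans xx.
by move=> u /SS' /sS [c cs uc]; exists c => //; exact: le_trans rr.
Qed.

Lemma coveredU S S' rho x y :
  covered S rho x -> covered S' rho y -> covered (S `|` S') rho (x + y).
Proof.
move=> [s [sx sS]] [t [ty tS]]; exists (s ++ t); split.
  by rewrite size_cat natrD lerD.
move=> u [/sS|/tS] [c cs uc]; exists c => //; rewrite mem_cat cs ?orbT //.
Qed.

Lemma covered_bigcup (S : nat -> set H) rho x n : 0 <= x ->
  (forall i, (i < n)%N -> covered (S i) rho x) ->
  covered (\bigcup_(i in `I_n) S i) rho (n%:R * x).
Proof.
move=> x0; elim: n => [|n IH] Sx.
  by exists [::]; rewrite mul0r; split => // u [].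
have {}IH : covered (\bigcup_(i in `I_n) S i) rho (n%:R * x).
  by apply: IH => i ilt; apply: Sx; exact: ltnW.
have := coveredU IH (Sx n (ltnSn n)).
apply: covered_mono => //; last by rewrite -natr1 mulrDl mul1r.
move=> u [i /= ilt Su]; move: ilt; rewrite ltnS leq_eqVlt => /orP[/eqP <-|ilt].
  by right.
by left; exists i.
Qed.

(** The finite union of closed balls is closed. *)
Lemma covered_closure S rho x : covered S rho x -> covered (closure S) rho x.
Proof.
move=> [s [sx sS]]; exists s; split => // u cu.
apply: contrapT => /forall2NP nu.
have : \forall v \near u, forall c, c \in s -> rho < `|v - c|.
  have {nu} : forall c, c \in s -> rho < `|u - c|.
    by move=> c cs; have [//|/negP] := nu c; rewrite -ltNge.
  elim: (s) => [|c t IH] nu; first by near=> v.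
  have h1 : \forall v \near u, rho < `|v - c|.
    have : `|v - c| @[v --> u] --> `|u - c|.
      by apply: cvg_norm; apply: cvgB; [exact: cvg_id|exact: cvg_cst].
    by move=> /cvgr_gt; apply; apply: nu; rewrite mem_head.
  have h2 : \forall v \near u, forall c, c \in t -> rho < `|v - c|.
    by apply: IH => a at_; apply: nu; rewrite inE at_ orbT.
  near=> v => a; rewrite inE => /orP[/eqP ->|]; first by near: v.
  by move: a; near: v.
move=> /cu [v [Sv nv]].
have [c cs vc] := sS _ Sv.
by have := lt_le_trans (nv c cs) vc; rewrite ltxx.
Unshelve. all: by end_near. Qed.

Lemma covered_by_entropy S rho x : 0 < rho -> (entropy S rho <= x%:E)%E ->
  covered S rho (expR x).
Proof.
move=> rho0; rewrite /entropy => Sx.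
have : (covering_number S rho < (expR x + 1)%:E)%E.
  case: (leP (covering_number S rho) 0%E) => [le0|gt0].
    by rewrite (le_lt_trans le0)// lte_fin ltr_wpDl ?expR_ge0.
  have cge0 : covering_number S rho \in `[0%E, +oo%E].
    by rewrite in_itv/= (ltW gt0) leey.
  have := Sx; rewrite -lee_expeR lneK //= => /le_lt_trans; apply.
  by rewrite lte_fin ltrDl.
move=> /ereal_inf_lt [_ [n [c nS] <-]]; rewrite lte_fin => nx.
(* the covering number is an infimum of integers, hence attained *)
pose Q n := `[< exists c : nat -> H,
  S `<=` \bigcup_(j in `I_n) closed_ball (c j) rho >].
have exQ : exists n, Q n by exists n; apply/asboolP; exists c.
have [N NP Nmin] := ex_minnP exQ.
move: NP => /asboolP [c' NS].
exists (mkseq c' N); split; last first.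
  move=> u /NS [j /= jN]; rewrite closed_ballE //= /closed_ball_ /= => uc.
  by exists (c' j); [apply/mapP; exists j => //; rewrite mem_iota|rewrite distrC].
rewrite size_mkseq.
have NE : (N%:R%:E <= covering_number S rho)%E.
  apply: le_ereal_inf_tmp => _ [k [ck kS] <-].
  by rewrite lee_fin ler_nat; apply: Nmin; apply/asboolP; exists ck.
have [N0|N0] := posnP N; first by rewrite N0 expR_ge0.
have cge0 : covering_number S rho \in `[0%E, +oo%E].
  by rewrite in_itv/= leey andbT (le_trans _ NE)// lee_fin.
have := Sx; rewrite -lee_expeR lneK //= => /(le_trans NE).
by rewrite lee_fin.
Qed.

Lemma entropy_le_ln_covered S rho x : 0 < rho -> 0 < x -> covered S rho x ->
  (entropy S rho <= (ln x)%:E)%E.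
Proof.
move=> rho0 x0 [s [sx sS]]; rewrite /entropy -lne_EFin //.
have ge0 : (0 <= covering_number S rho)%E.
  by apply: le_ereal_inf_tmp => _ [k _ <-]; rewrite lee_fin.
rewrite lee_lne ?in_itv /= ?ge0 ?leey ?lee_fin ?(ltW x0) //.
apply: (@le_trans _ _ (size s)%:R%:E); last by rewrite lee_fin.
apply: ereal_inf_lbound; exists (size s) => //=.
exists (nth 0 s) => u /sS [c cs uc].
exists (index c s); first by rewrite /= index_mem.
by rewrite nth_index // closed_ballE //= /closed_ball_ /= distrC.
Qed.

(** Replacing the centre of each ball that meets [S] by a point of [S] in that
    ball costs a factor 2 in the radius. *)
Lemma covered_centers S rho x : covered S rho x ->
  exists s : seq H, [/\ (size s)%:R <= x, forall u, u \in s -> S u &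
    forall u, S u -> exists2 c, c \in s & `|u - c| <= 2 * rho].
Proof.
move=> [t [tx tS]].
have : exists s : seq H, [/\ (size s <= size t)%N, forall u, u \in s -> S u &
    forall u c, S u -> c \in t -> `|u - c| <= rho ->
      exists2 v, v \in s & `|u - v| <= 2 * rho].
  elim: t {tx tS} => [|c t [s [st sS sP]]]; first by exists [::].
  have [[w [Sw wc]]|nc] := pselect (exists w, S w /\ `|w - c| <= rho).
    exists (w :: s); split => //= [u|u c' Su].
      by rewrite inE => /orP[/eqP ->//|]; exact: sS.
    rewrite inE => /orP[/eqP -> uc|c't uc']; last first.
      by have [v vs uv] := sP _ _ Su c't uc'; exists v => //; rewrite inE vs orbT.
    exists w; first by rewrite mem_head.
    rewrite -(subrKA c) (le_trans (ler_normD _ _)) // mulr_natl mulr2n lerD //.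
    by rewrite distrC.
  exists s; split => [|//|u c' Su]; first exact: leqW.
  rewrite inE => /orP[/eqP -> uc|]; last exact: sP.
  by exfalso; apply: nc; exists u.
move=> [s [st sS sP]]; exists s; split => // [|u Su].
  by rewrite (le_trans _ tx) // ler_nat.
by have [c ct uc] := tS u Su; exact: sP ct uc.
Qed.

Lemma covered_select (alive : nat -> Prop) (q : nat -> H) rho x :
  covered [set q i | i in [set i | alive i]] rho x ->
  exists s : seq nat, [/\ (size s)%:R <= x, forall i, i \in s -> alive i &
    forall i, alive i -> exists2 j, j \in s & `|q i - q j| <= 2 * rho].
Proof.
move=> /covered_centers[s [sx sS sP]].
have [t ts talive] : exists2 t : seq nat, map q t = s &
    forall i, i \in t -> alive i.
  elim: s sS {sx sP} => [|u s IH] sS; first by exists [::].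
  have [|t <- tP] := IH; first by move=> v vs; apply: sS; rewrite inE vs orbT.
  have [i ia <-] := sS u (mem_head _ _).
  by exists (i :: t) => // j; rewrite inE => /orP[/eqP ->|/tP].
exists t; split => // [|i ia]; first by rewrite -(size_map q) ts.
have [|c] := sP (q i); first by exists i.
by rewrite -ts => /mapP[j jt ->] ij; exists j.
Qed.

End Covering.

(** The smoothing estimate turns covers into covers: [F] maps the part of [S] in
    a ball of radius [2 * rho] around a point of [S] into a translate of the image
    of the [V]-ball of radius [2 * rho * L], which is a rescaled unit ball. *)
Lemma covered_image {R : realType} {V H : normedModType R}
    (iota : {linear V -> H}) (F : H -> H) (S : set H) (rho L x eps y : R) :
  0 < rho -> 0 < L ->
  (forall u1 u2, S u1 -> S u2 ->
    exists2 v, iota v = F u1 - F u2 & `|v| <= L * `|u1 - u2|) ->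
  covered S rho x ->
  covered (iota @` closed_ball 0 1) eps y ->
  covered (F @` S) (2 * rho * L * eps) (x * y).
Proof.
move=> rho0 L0 FL /covered_centers[a [ax aS aP]] [b [yb bS]].
have l0 : 0 < 2 * rho * L by rewrite !mulr_gt0.
exists [seq F c + (2 * rho * L) *: w | c <- a, w <- b]; split.
  by rewrite size_allpairs natrM ler_pM.
move=> _ [u Su <-].
have [c ca uc] := aP _ Su.
have [v vE vL] := FL _ _ Su (aS _ ca).
have [|w wb vw] := bS (iota ((2 * rho * L)^-1 *: v)).
  exists ((2 * rho * L)^-1 *: v) => //.
  rewrite closed_ballE //= /closed_ball_ /= sub0r normrN normrZ gtr0_norm ?invr_gt0 //.
  rewrite mulrC ler_pdivrMr // mul1r (le_trans vL) // [leRHS]mulrC.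
  by rewrite ler_pM2l.
exists (F c + (2 * rho * L) *: w); first exact: allpairs_f.
have -> : F u - (F c + (2 * rho * L) *: w) =
    (2 * rho * L) *: (iota ((2 * rho * L)^-1 *: v) - w).
  by rewrite linearZ /= vE opprD addrA scalerBr scalerA divff ?gt_eqF // scale1r.
by rewrite normrZ gtr0_norm // ler_pM2l.
Qed.

(** On a totally bounded set every ultrafilter is Cauchy, hence convergent. *)
Lemma compact_of_covered {R : realType} {H : completeNormedModType R}
    (S : set H) : closed S ->
  (forall e : R, 0 < e -> exists x, covered S e x) -> compact S.
Proof.
move=> cS tb; rewrite compact_ultra => F FU FS.
have Fcauchy : cauchy F.
  apply/cauchyP => /= e e0.
  have [x [s [_ sS]]] := tb (e / 2) (divr_gt0 e0 (ltr0n _ 2)).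
  have : exists2 c, c \in s & F [set u | `|u - c| <= e / 2].
    have : F [set u | exists2 c, c \in s & `|u - c| <= e / 2].
      by apply: filterS FS => u /sS.
    elim: (s) => [|c t IH] Fs.
      by exfalso; apply: (@filter_not_empty _ F); apply: filterS Fs => u [].
    have [Fc|Fc] := @in_ultra_setVsetC _ F [set u | `|u - c| <= e / 2] FU.
      by exists c => //; rewrite mem_head.
    have [|c' c't Fc'] := IH.
      apply: filterS2 Fs Fc => u [c']; rewrite inE => /orP[/eqP -> //|c't uc _].
      by exists c'.
    by exists c' => //; rewrite inE c't orbT.
  move=> [c _ Fc]; exists c; apply: filterS Fc => u /= uc.
  rewrite -ball_normE /= distrC (le_lt_trans uc) // ltr_pdivrMr //.
  by rewrite mulr_natr mulr2n ltrDl.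
have Fl : F --> lim F by exact: cauchy_cvg.
exists (lim F); split => //.
by apply: cS => B /Fl FB; exact: filter_ex (filterI FS FB).
Qed.

(** * Measurable formulas *)

Section MeasurableFormulas.
Context {d : measure_display} {Omega : measurableType d}.
Implicit Types (Q : nat -> Omega -> Prop).

Lemma measurable_set_exists Q : (forall i, measurable [set w | Q i w]) ->
  measurable [set w | exists i, Q i w].
Proof.
move=> mQ; rewrite (_ : [set _ | _] = \bigcup_i [set w | Q i w]).
  exact: bigcupT_measurable.
by apply/seteqP; split => w [i]; exists i.
Qed.

Lemma measurable_set_forall Q : (forall i, measurable [set w | Q i w]) ->
  measurable [set w | forall i, Q i w].
Proof.
move=> mQ; rewrite (_ : [set _ | _] = \bigcap_i [set w | Q i w]).
  exact: bigcapT_measurable.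
by apply/seteqP; split => w /= Qw i; [move=> _|]; exact: Qw.
Qed.

Lemma measurable_set_not (F : Omega -> Prop) :
  measurable [set w | F w] -> measurable [set w | ~ F w].
Proof. exact: measurableC. Qed.

Lemma measurable_set_and (F F' : Omega -> Prop) : measurable [set w | F w] ->
  measurable [set w | F' w] -> measurable [set w | F w /\ F' w].
Proof. exact: measurableI. Qed.

Lemma measurable_set_cst (F : Prop) : measurable [set _ : Omega | F].
Proof.
have [f|nf] := pselect F.
  by rewrite (_ : [set _ | _] = setT) //; apply/seteqP; split.
by rewrite (_ : [set _ | _] = set0) //; apply/seteqP; split.
Qed.

Lemma measurable_set_imply (F F' : Omega -> Prop) : measurable [set w | F w] ->
  measurable [set w | F' w] -> measurable [set w | F w -> F' w].
Proof.
move=> mF mF'; rewrite (_ : [set _ | _] = ~` [set w | F w] `|` [set w | F' w]).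
  by apply: measurableU => //; exact: measurableC.
apply/seteqP; split => w /=; last by move=> [|] //.
by move=> FF'; have [/FF'|] := pselect (F w); [right|left].
Qed.

End MeasurableFormulas.

Lemma measurable_set_ltr {R : realType} d (T : measurableType d) (f g : T -> R) :
  measurable_fun [set: T] f -> measurable_fun [set: T] g ->
  measurable [set x | f x < g x].
Proof.
move=> mf mg; rewrite -[X in measurable X]setTI.
exact: (measurable_fun_ltr mf mg measurableT (Y := [set true])).
Qed.

Lemma measurable_set_ler {R : realType} d (T : measurableType d) (f g : T -> R) :
  measurable_fun [set: T] f -> measurable_fun [set: T] g ->
  measurable [set x | f x <= g x].
Proof.
move=> mf mg; rewrite -[X in measurable X]setTI.
exact: (measurable_fun_ler mf mg measurableT (Y := [set true])).
Qed.

(** * The maximal ergodic inequality *)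

Section MaximalErgodic.
Context {R : realType} {d : measure_display} {Omega : measurableType d}
  (P : probability Omega R) (tau : Omega -> Omega).
Hypothesis mtau : measurable_fun [set: Omega] tau.
Hypothesis Ptau : forall E : set Omega, measurable E -> P (tau @^-1` E) = P E.

Definition birkhoff_sum (f : Omega -> R) (n : nat) (w : Omega) : R :=
  \sum_(i < n) f (iter i tau w).

Lemma birkhoff_sumS f n w :
  birkhoff_sum f n.+1 w = f w + birkhoff_sum f n (tau w).
Proof.
rewrite /birkhoff_sum big_ord_recl /=; congr (_ + _).
by apply: eq_bigr => i _; rewrite -iterSr.
Qed.

Lemma measurable_iter_comp d' (T : measurableType d') (f : Omega -> T) i :
  measurable_fun [set: Omega] f ->
  measurable_fun [set: Omega] (fun w => f (iter i tau w)).
Proof.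
move=> mf; elim: i => [//|i IH]; under eq_fun do rewrite iterSr.
exact: (measurableT_comp IH mtau).
Qed.

Lemma measurable_birkhoff_sum f n : measurable_fun [set: Omega] f ->
  measurable_fun [set: Omega] (birkhoff_sum f n).
Proof.
by move=> mf; apply: measurable_sum => i; exact: measurable_iter_comp.
Qed.

Lemma integral_measure_preserving (f : Omega -> R) :
  measurable_fun [set: Omega] f -> (forall w, 0 <= f w) ->
  (\int[P]_w (f (tau w))%:E = \int[P]_w (f w)%:E)%E.
Proof.
move=> mf f0.
rewrite -(ge0_integral_pushforward mtau P measurableT (f := EFin \o f)) //=.
- by apply: eq_measure_integral => A mA _; exact: Ptau.
- exact/measurable_EFinP.
- by move=> w _; rewrite lee_fin.
Qed.

(** This is the maximum of 0 and the first [n] Birkhoff sums of [g], in the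
    recursive form on which Garsia's argument relies. *)
Fixpoint max_sum (g : Omega -> R) (n : nat) (w : Omega) : R :=
  if n is k.+1 then Num.max 0 (g w + max_sum g k (tau w)) else 0.

Lemma max_sum_ge0 g n w : 0 <= max_sum g n w.
Proof. by case: n => //= n; rewrite le_max lexx. Qed.

Lemma le_max_sumS g n w : max_sum g n w <= max_sum g n.+1 w.
Proof.
elim: n w => [|n IH] w; first exact: max_sum_ge0.
rewrite /= ge_max !le_max lexx lerD2l /=; apply/orP; right; exact: IH.
Qed.

Lemma birkhoff_sum_le_max_sum f l n w :
  birkhoff_sum f n w - n%:R * l <= max_sum (fun w => f w - l) n w.
Proof.
elim: n w => [|n IH] w; first by rewrite /birkhoff_sum big_ord0 mul0r subrr.
rewrite birkhoff_sumS /= le_max; apply/orP; right.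
rewrite -natr1 mulrDl mul1r opprD [- _ - l]addrC addrACA lerD2l.
exact: IH.
Qed.

Lemma measurable_max_sum g n : measurable_fun [set: Omega] g ->
  measurable_fun [set: Omega] (max_sum g n).
Proof.
move=> mg; elim: n => [|n IH] /=; first exact: measurable_cst.
apply: measurable_maxr; first exact: measurable_cst.
by apply: measurable_funD => //; exact: (measurableT_comp IH mtau).
Qed.

Section Nonnegative.
Variables (f : Omega -> R).
Hypothesis mf : measurable_fun [set: Omega] f.
Hypothesis f0 : forall w, 0 <= f w.
Hypothesis f_fin : (\int[P]_w (f w)%:E < +oo)%E.

Lemma integral_max_sum_fin l n : 0 <= l ->
  (\int[P]_w (max_sum (fun w => f w - l) n w)%:E < +oo)%E.
Proof.
move=> l0; have mg : measurable_fun [set: Omega] (fun w => f w - l).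
  by apply: measurable_funB => //; exact: measurable_cst.
elim: n => [|n IH] /=; first by rewrite integral0.
apply: (@le_lt_trans _ _
  (\int[P]_w ((f w)%:E + (max_sum (fun w => f w - l) n (tau w))%:E))%E).
  apply: ge0_le_integral => //.
  - by move=> w _; rewrite lee_fin; exact: (max_sum_ge0 _ n.+1).
  - by apply/measurable_EFinP; exact: (measurable_max_sum n.+1).
  - apply: emeasurable_funD; first exact/measurable_EFinP.
    apply/measurable_EFinP.
    exact: (measurableT_comp (measurable_max_sum n mg) mtau).
  - move=> w _; rewrite lee_fin ge_max addr_ge0 ?max_sum_ge0 //=.
    by rewrite lerD2r lerBlDr lerDl.
rewrite ge0_integralD //=.
- rewrite (integral_measure_preserving (measurable_max_sum n mg)).
    by rewrite lte_add_pinfty.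
  by move=> w; exact: max_sum_ge0.
- by move=> w _; rewrite lee_fin.
- exact/measurable_EFinP.
- by move=> w _; rewrite lee_fin max_sum_ge0.
- by apply/measurable_EFinP; exact: (measurableT_comp (measurable_max_sum n mg) mtau).
Qed.

(** Where [F_{n+1}], the function [max_sum g n.+1], is positive it equals
    [f - l + F_n o tau], and elsewhere it vanishes; so
    [F_{n+1} + l 1_{F_{n+1} > 0} <= f + F_n o tau] everywhere. In the integrals,
    [tau] disappears and [F_n <= F_{n+1}] cancels. *)
Lemma max_sum_gt0_le l n : 0 <= l ->
  (l%:E * P [set w | 0 < max_sum (fun w => f w - l)%R n w]%R
    <= \int[P]_w (f w)%:E)%E.
Proof.
move=> l0; set g := fun w => f w - l.
have mg : measurable_fun [set: Omega] g.
  by apply: measurable_funB => //; exact: measurable_cst.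
have mE k : measurable [set w | 0 < max_sum g k w].
  by apply: measurable_set_ltr => //; exact: measurable_max_sum.
case: n => [|n].
  rewrite (_ : [set _ | _] = set0); last first.
    by apply/seteqP; split => w //=; rewrite ltxx.
  by rewrite measure0 mule0 integral_ge0 // => w _; rewrite lee_fin.
have F0 k w : (0 <= (max_sum g k w)%:E)%E by rewrite lee_fin max_sum_ge0.
have mF k : measurable_fun [set: Omega] (EFin \o max_sum g k).
  by apply/measurable_EFinP; exact: measurable_max_sum.
have : (\int[P]_w ((max_sum g n.+1 w)%:E
      + (l * \1_[set w | (0 < max_sum g n.+1 w)%R] w)%:E)
    <= \int[P]_w ((f w)%:E + (max_sum g n (tau w))%:E))%E.
  apply: ge0_le_integral => //.
  - by move=> w _; rewrite adde_ge0 // lee_fin mulr_ge0.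
  - apply: emeasurable_funD; first exact: mF.
    apply/measurable_EFinP; apply: measurable_funM; first exact: measurable_cst.
    exact: measurable_indic.
  - apply: emeasurable_funD; first exact/measurable_EFinP.
    apply/measurable_EFinP.
    exact: (measurableT_comp (measurable_max_sum n mg) mtau).
  - move=> w _; rewrite -!EFinD lee_fin indicE.
    have [/set_mem/= pos|/negP npos] := boolP (w \in _).
      move: pos; rewrite lt_max ltxx /= => pos.
      by rewrite (max_idPr (ltW pos)) mulr1 /g addrAC subrK.
    have -> : max_sum g n.+1 w = 0.
      apply/eqP; rewrite eq_le (max_sum_ge0 g n.+1) andbT leNgt.
      by apply/negP => pos; apply: npos; rewrite inE.
    by rewrite mulr0 addr0 addr_ge0 // max_sum_ge0.
rewrite ge0_integralD //; last 3 first.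
  - exact: mF.
  - by move=> w _; rewrite lee_fin mulr_ge0.
  - apply/measurable_EFinP; apply: measurable_funM; first exact: measurable_cst.
    exact: measurable_indic.
rewrite ge0_integralD //; last 3 first.
  - by move=> w _; rewrite lee_fin.
  - exact/measurable_EFinP.
  - apply/measurable_EFinP.
    exact: (measurableT_comp (measurable_max_sum n mg) mtau).
rewrite (integral_measure_preserving (measurable_max_sum n mg)); last first.
  by move=> w; exact: max_sum_ge0.
under [X in (_ + X <= _)%E]eq_integral do rewrite EFinM.
rewrite ge0_integralZl_EFin //; last first.
  - by apply/measurable_EFinP; exact: measurable_indic.
rewrite integral_indic // setIT.
have le : (\int[P]_w (max_sum g n w)%:E <= \int[P]_w (max_sum g n.+1 w)%:E)%E.
  apply: ge0_le_integral => //; [exact: mF|exact: mF|].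
  by move=> w _; rewrite lee_fin; exact: le_max_sumS.
move=> /le_trans/(_ (leeD2l _ le)).
rewrite [leRHS]addeC leeD2lE //.
rewrite ge0_fin_numE; first exact: integral_max_sum_fin.
by apply: integral_ge0.
Qed.

Lemma maximal_inequality l : 0 <= l ->
  (l%:E * P [set w | exists n, n%:R * l < birkhoff_sum f n w]%R
    <= \int[P]_w (f w)%:E)%E.
Proof.
move=> l0; set g := fun w => f w - l.
have mg : measurable_fun [set: Omega] g.
  by apply: measurable_funB => //; exact: measurable_cst.
pose E n := [set w | 0 < max_sum g n w].
have mE k : measurable (E k).
  by apply: measurable_set_ltr => //; exact: measurable_max_sum.
have mU : measurable (\bigcup_n E n) by exact: bigcupT_measurable.
have ndE : nondecreasing_seq E.
  apply/nondecreasing_seqP => n; apply/subsetPset => w /= /lt_le_trans; apply.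
  exact: le_max_sumS.
apply: (@le_trans _ _ (l%:E * P (\bigcup_n E n))%E).
  apply: lee_wpmul2l; first by rewrite lee_fin.
  apply: le_measure; rewrite ?inE //.
    rewrite (_ : [set _ | _] = \bigcup_n [set w | n%:R * l < birkhoff_sum f n w]).
      apply: bigcupT_measurable => n.
      by apply: measurable_set_ltr => //; exact: measurable_birkhoff_sum.
    by apply/seteqP; split => w [n]; exists n.
  move=> w [n nw]; exists n => //; rewrite /E /=.
  by rewrite (lt_le_trans _ (birkhoff_sum_le_max_sum f l n w)) // subr_gt0.
have cvgE : (l%:E * P (E n))%E @[n --> \oo] --> (l%:E * P (\bigcup_n E n))%E.
  by apply: cvgeZl => //; exact: nondecreasing_cvg_mu.
rewrite -(cvg_lim _ cvgE) //; apply: lime_le; first by apply/cvg_ex; eexists; exact: cvgE.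
by apply: nearW => n; exact: max_sum_gt0_le.
Qed.

(** The points where [S_n / n] is unbounded belong, for every [k], to the set
    where [S_n > n k] for some [n], whose probability is at most the integral of
    [f] divided by [k]. *)
Lemma birkhoff_sum_linear_growth :
  {ae P, forall w, exists c, forall n, birkhoff_sum f n w <= n%:R * c}.
Proof.
pose B k := [set w | exists n, n%:R * k.+1%:R < birkhoff_sum f n w].
have mB k : measurable (B k).
  rewrite (_ : B k = \bigcup_n [set w | n%:R * k.+1%:R < birkhoff_sum f n w]).
    apply: bigcupT_measurable => n.
    by apply: measurable_set_ltr => //; exact: measurable_birkhoff_sum.
  by apply/seteqP; split => w [n]; exists n.
have mI : measurable (\bigcap_k B k) by exact: bigcapT_measurable.
exists (\bigcap_k B k); split => //; last first.
  move=> w /= nc k _; apply: contrapT => nB; apply: nc; exists k.+1%:R => n.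
  by rewrite leNgt; apply/negP => lt; apply: nB; exists n.
have I0 : (0 <= \int[P]_w (f w)%:E)%E by apply: integral_ge0 => w _; rewrite lee_fin.
have If : (\int[P]_w (f w)%:E)%E \is a fin_num by rewrite ge0_fin_numE.
have Pf : P (\bigcap_k B k) \is a fin_num by exact: fin_num_measure.
apply/eqP; rewrite eq_le measure_ge0 andbT leNgt; apply/negP.
rewrite -(fineK Pf) lte_fin => p0.
(* a threshold exceeding I / p contradicts the maximal inequality *)
set p := fine _ in p0; set I := fine (\int[P]_w (f w)%:E)%E.
have := @maximal_inequality (Num.trunc (I / p)).+1%:R (ler0n _ _).
apply/negP; rewrite -ltNge -(fineK If) -/I.
apply: (@lt_le_trans _ _ ((Num.trunc (I / p)).+1%:R%:E * p%:E)%E).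
  rewrite -EFinM lte_fin -ltr_pdivrMr //.
  by apply: truncnS_gt.
apply: lee_wpmul2l; first by rewrite lee_fin.
rewrite /p fineK //; apply: le_measure; rewrite ?inE //; first exact: mB.
by move=> w; apply.
Qed.

End Nonnegative.
End MaximalErgodic.

(** * Random points of a separable space *)

Section RandomPoints.
Context {R : realType} {H : normedModType R} {d : measure_display}
  {Omega : measurableType d}.

Lemma exists_dense_sequence : separable_space H ->
  exists h : nat -> H, forall x (e : R), 0 < e -> exists i, `|x - h i| < e.
Proof.
move=> [D [cD dD]].
have [f finj] := countable_injP _ cD.
exists (fun n => xget 0 [set x | D x /\ f x = n]) => x e e0.
have [|y [/= yx Dy]] := dD (ball x e) _ (ball_open x e).
  by exists x; exact: ballxx.
exists (f y).
have [z _ [Dz fz]|/(_ y) nD] := xgetP; last by exfalso; exact: nD.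
have -> : z = y by apply: finj => //; exact: mem_set.
by move: yx; rewrite -ball_normE.
Qed.

Lemma measurable_fun_sublevel (f : Omega -> R) :
  (forall a, measurable [set w | f w < a]) -> measurable_fun [set: Omega] f.
Proof.
move=> fa; apply: (measurability _ (RGenInftyO.measurableE R)) => //.
move=> _ [_ [a ->] <-]; rewrite setTI (_ : _ @^-1` _ = [set w | f w < a]) //.
Qed.

Lemma measurable_dist_cst (X : Omega -> borel H) (x : H) :
  measurable_fun [set: Omega] X ->
  measurable_fun [set: Omega] (fun w => `|(X w : H) - x|).
Proof.
move=> mX; apply: measurable_fun_sublevel => a.
have /(mX measurableT) : measurable ([set y : H | `|y - x| < a] : set (borel H)).
  apply: sub_sigma_algebra.
  have -> : [set y : H | `|y - x| < a] = (fun y => `|y - x|) @^-1` [set t | t < a].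
    by [].
  apply: open_comp; last exact: open_lt.
  move=> y _; apply: cvg_norm; apply: cvgB; [exact: cvg_id|exact: cvg_cst].
by rewrite setTI.
Qed.

(** Through the dense sequence, the distance of two random points becomes a
    countable infimum of sums of distances to fixed points. *)
Lemma measurable_dist (h : nat -> H) (X Y : Omega -> borel H) :
  (forall x (e : R), 0 < e -> exists i, `|x - h i| < e) ->
  measurable_fun [set: Omega] X -> measurable_fun [set: Omega] Y ->
  measurable_fun [set: Omega] (fun w => `|(X w : H) - (Y w : H)|).
Proof.
move=> hd mX mY; apply: measurable_fun_sublevel => a.
rewrite (_ : [set _ | _] =
    \bigcup_i [set w | `|(X w : H) - h i| + `|(Y w : H) - h i| < a]).
  apply: bigcupT_measurable => i; apply: measurable_set_ltr => //.
  by apply: measurable_funD; exact: measurable_dist_cst.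
apply/seteqP; split => w /=; last first.
  move=> [i _]; apply: le_lt_trans.
  by rewrite -(subrKA (h i)) (le_trans (ler_normD _ _)) // lerD2l distrC.
move=> lta; have [|i ih] := hd (Y w) ((a - `|(X w : H) - (Y w : H)|) / 2).
  by rewrite divr_gt0 // subr_gt0.
exists i => //=; apply: (@le_lt_trans _ _
    (`|(X w : H) - (Y w : H)| + (`|(Y w : H) - h i| + `|(Y w : H) - h i|))).
  by rewrite addrA lerD2r -{1}(subrKA (Y w : H)) ler_normD.
by rewrite -ltrBrDl -mulr2n -mulr_natr -ltr_pdivlMr.
Qed.

End RandomPoints.

(** * Distances to sets and fractal dimension *)

Section DistanceAndDimension.
Context {R : realType} {H : normedModType R}.

Lemma dist_pt_ltP (N : H -> \bar R) (u : H) (S : set H) (a : \bar R) :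
  (dist_pt N u S < a)%E <-> exists2 v, S v & (N (u - v)%R < a)%E.
Proof.
split; first by move=> /ereal_inf_lt[_ [v Sv <-]]; exists v.
by move=> [v Sv]; apply: le_lt_trans; apply: ereal_inf_lbound; exists v.
Qed.

Lemma dist_pt_le (N : H -> \bar R) (u v : H) (S : set H) (a : \bar R) :
  S v -> (N (u - v)%R <= a)%E -> (dist_pt N u S <= a)%E.
Proof. by move=> Sv; apply: le_trans; apply: ereal_inf_lbound; exists v. Qed.

Lemma dist_pt_closure_ltP (u : H) (S : set H) (a : \bar R) :
  (dist_pt normH u (closure S) < a)%E <-> exists2 v, S v & (normH (u - v)%R < a)%E.
Proof.
split; last first.
  move=> [v Sv uv]; apply/dist_pt_ltP; exists v => //; exact: subset_closure.
move=> /dist_pt_ltP[v cv]; rewrite /normH; case: a => [a| |] //; last first.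
  by have [x [Sx _]] := cv setT filterT; exists x; rewrite ?ltry.
rewrite lte_fin => uva.
have e0 : 0 < a - `|u - v| by rewrite subr_gt0.
have [x [Sx vx]] := cv _ (nbhsx_ballx v _ e0).
exists x => //; rewrite lte_fin -(subrKA v) (le_lt_trans (ler_normD _ _)) //.
by move: vx; rewrite -ball_normE /= ltrBrDl.
Qed.

Lemma measurable_fun_esublevel d (Omega : measurableType d) (f : Omega -> \bar R) :
  (forall a : R, measurable [set w | (f w < a%:E)%E]) ->
  measurable_fun [set: Omega] f.
Proof.
move=> fa; apply: (measurability _ (ErealGenInftyO.measurableE R)) => //.
move=> _ [_ [a ->] <-]; rewrite setTI.
exact: fa.
Qed.

Lemma normV_le {V : normedModType R} (iota : {linear V -> H}) (x : H) (c : R) :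
  injective iota -> (normV iota x <= c%:E)%E ->
  exists2 v, iota v = x & `|v| <= c.
Proof.
move=> inj Nx.
have [[v vx]|nv] := pselect (exists v, iota v = x); last first.
  move: Nx; rewrite /normV (_ : [set _ | _ in _] = set0) ?ereal_inf0 //.
  by apply/seteqP; split => y // [v vx _]; apply: nv; exists v.
exists v => //; move: Nx; rewrite /normV (_ : [set _ | _ in _] = [set `|v|%:E]).
  by rewrite ereal_inf1 lee_fin.
apply/seteqP; split => [_ [v' v'x <-]|_ ->]; last by exists v.
by congr (`|_|%:E); apply: inj; rewrite v'x.
Qed.

(** At scale [e], use the cover of index [n], the least integer above
    [ln (a / e)]; then [n + 1 <= ln a + ln e^-1 + 2], which is at most
    [2 * ln e^-1] as soon as [ln e^-1] exceeds [ln a + 2]. *)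
Lemma fractal_dim_le (S : set H) (a c : R) : 0 < a -> 0 <= c ->
  (forall n, covered S (expR (- n%:R) * a) (expR (c * n.+1%:R))) ->
  (fractal_dim S <= (2 * c)%:E)%E.
Proof.
move=> a0 c0 cov.
pose b := expR (- (`|ln a| + 2)).
have b0 : 0 < b by exact: expR_gt0.
apply: ge_ereal_inf; exists (ereal_sup [set (entropy S e * ((ln e^-1)^-1)%:E)%E | e in
    [set e : R | (0 < e < b) && (e < a)]]).
  exists [set e | (0 < e < b) && (e < a)] => //.
  near=> e; apply/andP; split; last by near: e; apply: nbhs_right_lt.
  by apply/andP; split; near: e; [exact: nbhs_right_gt|exact: nbhs_right_lt].
apply: ge_ereal_sup => _ [e /= /andP[/andP[e0 eb] ea] <-].
have lne : `|ln a| + 2 < ln e^-1.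
  rewrite lnV ?posrE // ltrNr -ltr_expR lnK ?posrE //.
have lne0 : 0 < ln e^-1 by rewrite (le_lt_trans _ lne) // addr_ge0.
have lnae : 0 <= ln (a / e) by rewrite ln_ge0 // ler_pdivlMr // mul1r ltW.
have lnaeE : ln (a / e) = ln a + ln e^-1 by rewrite lnM ?posrE ?invr_gt0.
set n := (Num.trunc (ln (a / e))).+1.
have nlow : ln (a / e) <= n%:R by rewrite ltW // truncnS_gt.
have nup : n%:R <= ln (a / e) + 1.
  by rewrite /n -natr1 lerD2r truncn_le.
have covn : covered S e (expR (c * n.+1%:R)).
  apply: covered_mono (cov n) => //.
  rewrite expRN mulrC ler_pdivrMr ?expR_gt0 // mulrC -ler_pdivrMr //.
  by rewrite -[leLHS]lnK ?posrE ?divr_gt0 // ler_expR.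
apply: (@le_trans _ _ ((c * n.+1%:R)%:E * ((ln e^-1)^-1)%:E)%E).
  apply: lee_wpmul2r; first by rewrite lee_fin invr_ge0 ltW.
  have := entropy_le_ln_covered e0 (expR_gt0 _) covn.
  by rewrite expRK.
rewrite -EFinM lee_fin ler_pdivrMr // [2 * c]mulrC -mulrA ler_wpM2l //.
rewrite -natr1; have := ler_norm (ln a); rewrite lnaeE in nup.
lra.
Unshelve. all: by end_near. Qed.

End DistanceAndDimension.

(** * The attractor of a smoothing random dynamical system *)

Section Construction.
Context {R : realType} {H : completeNormedModType R} {d : measure_display}
  {Omega : measurableType d} (P : probability Omega R)
  (sigma : int -> Omega -> Omega) (psi : nat -> Omega -> H -> H)
  (A : Omega -> set H) (r : R) (h : nat -> H) (kappa f : Omega -> R).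

Definition past (n : nat) (w : Omega) : Omega := sigma (- n%:Z) w.

(** The cocycle law only makes [psi 0 w] an idempotent; [flow] agrees with [psi]
    for positive times and starts from the identity. *)
Definition flow (n : nat) (w : Omega) : H -> H :=
  if n is 0 then id else psi n w.

(** With this radius, [psi 1 w] maps a ball into a translate of a [V]-ball of
    radius [expR (- n%:R) * r], whatever [w] is: [kappa w] stands for its
    Lipschitz constant. *)
Definition radius (n : nat) (w : Omega) : R := expR (- n%:R) * (r / kappa w).

Definition enlargement (w : Omega) : set H :=
  [set u | (dist_pt normH u (A w) < (radius 0 w / 2)%:E)%E].

Definition pullback (n : nat) (w : Omega) : set H :=
  flow n (past n w) @` enlargement (past n w).

Definition net_point (n i : nat) (w : Omega) : H := flow n (past n w) (h i).

Definition admissible (n i : nat) (w : Omega) : Prop :=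
  enlargement (past n w) (h i).

Definition budget (n : nat) (w : Omega) : R :=
  expR (birkhoff_sum (sigma (-1)) f n w).

Definition index_list (c : nat) : seq nat := odflt [::] (unpickle c).

Definition is_net (n c : nat) (w : Omega) : Prop :=
  [/\ forall i, i \in index_list c -> admissible n i w,
      forall i, admissible n i w -> exists j, j \in index_list c /\
        `|net_point n i w - net_point n j w| <= 2 * radius n w &
      (size (index_list c))%:R <= budget n.+1 w].

Definition chosen_net (n c : nat) (w : Omega) : Prop :=
  is_net n c w /\ forall c', (c' < c)%N -> ~ is_net n c' w.

Definition selected (n i : nat) (w : Omega) : Prop :=
  exists c, chosen_net n c w /\ i \in index_list c.

(** The points [net_point (j + n) i w] are the images under [flow j] of the points
    of the net of order [n] at time [-j]. The second set makes the union invariant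
    under the idempotent [psi 0 w]: it can only move the points of the net of order
    [0] at time [0], every other point being in the range of [psi 0 w]. *)
Definition skeleton (w : Omega) : set H :=
  [set x | exists j n i, selected n i (past j w) /\ x = net_point (j + n) i w]
  `|` [set x | exists i, selected 0 i w /\ x = psi 0 w (h i)].

Definition attractor (G : set Omega) (w : Omega) : set H :=
  if w \in G then closure (skeleton w) else [set 0].

Hypothesis sigma0 : forall w, sigma 0 w = w.
Hypothesis sigmaD : forall k l w, sigma (k + l) w = sigma k (sigma l w).

Lemma past0 w : past 0 w = w. Proof. by rewrite /past oppr0 sigma0. Qed.

Lemma pastD k l w : past (k + l) w = past k (past l w).
Proof. by rewrite /past PoszD opprD sigmaD. Qed.

Lemma pastK k w : sigma k%:Z (past k w) = w.
Proof. by rewrite /past -sigmaD subrr sigma0. Qed.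

Lemma sigmaK k w : past k (sigma k%:Z w) = w.
Proof. by rewrite /past -sigmaD addNr sigma0. Qed.

Section Pathwise.
Variable G : set Omega.
Hypothesis Gsigma : forall w k, G w -> G (sigma k w).
Hypothesis r_gt0 : 0 < r.
Hypothesis kappa_ge1 : forall w, 1 <= kappa w.
Hypothesis f_ge0 : forall w, 0 <= f w.
Hypothesis h_dense : forall x (e : R), 0 < e -> exists i, `|x - h i| < e.
Hypothesis psi_cont : forall k w, continuous (psi k w).
Hypothesis psiD : forall w k l u, G w ->
  psi (k + l) w u = psi k (sigma l%:Z w) (psi l w u).
Hypothesis A_stable : forall w u, G w -> closed_nbhd r (A w) u ->
  A (sigma 1 w) (psi 1 w u).
Hypothesis A_covered : forall w, G w -> covered (A w) (radius 0 w / 2) (expR (f w)).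
Context (V : normedModType R) (iota : {linear V -> H}).
Hypothesis iota_inj : injective iota.
Hypothesis psi_smoothing : forall w u1 u2, G w -> closed_nbhd r (A w) u1 ->
  closed_nbhd r (A w) u2 ->
  (normV iota (psi 1 w u1 - psi 1 w u2)%R <= (kappa w * `|u1 - u2|)%:E)%E.
Hypothesis V_covered : forall w, G w ->
  covered (iota @` closed_ball 0 1) (2 * expR 1 * kappa w)^-1 (expR (f w)).

Lemma Gpast k w : G w -> G (past k w). Proof. exact: Gsigma. Qed.

Lemma kappa_gt0 w : 0 < kappa w.
Proof. exact: lt_le_trans (kappa_ge1 w). Qed.

Lemma radius_gt0 n w : 0 < radius n w.
Proof. by rewrite mulr_gt0 ?expR_gt0 // divr_gt0 // kappa_gt0. Qed.

Lemma radius_le n w : radius n w <= expR (- n%:R) * r.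
Proof.
rewrite ler_pM2l ?expR_gt0 // ler_pdivrMr ?kappa_gt0 //.
by rewrite ler_peMr // ltW.
Qed.

(** Both sides are exponentials of sums along the past of [w], over the times from
    [-j] back on the left and from [0] back on the right. *)
Lemma budgetD j n w : budget n (past j w) <= budget (j + n) w.
Proof.
rewrite ler_expR; elim: j w => [|j IH] w; first by rewrite past0.
rewrite addSn birkhoff_sumS -addn1 pastD.
by rewrite (le_trans (IH _)) // lerDr.
Qed.

Lemma budget_ge1 n w : 1 <= budget n w.
Proof. by rewrite -expR0 ler_expR sumr_ge0. Qed.

Lemma leq_budget m n w : (m <= n)%N -> budget m w <= budget n w.
Proof.
move=> /subnKC <-; rewrite ler_expR /birkhoff_sum big_split_ord /= lerDl.
exact: sumr_ge0.
Qed.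

Lemma subset_enlargement w : A w `<=` enlargement w.
Proof.
move=> u Au; apply/dist_pt_ltP; exists u => //.
by rewrite /normH subrr normr0 lte_fin divr_gt0 ?radius_gt0.
Qed.

Lemma enlargement_sub_nbhd w : enlargement w `<=` closed_nbhd r (A w).
Proof.
move=> u /ltW /le_trans; apply; rewrite lee_fin.
have := radius_le 0 w; have := radius_gt0 0 w.
rewrite oppr0 expR0 mul1r; lra.
Qed.

Lemma enlargement_open w u : enlargement w u ->
  exists2 e : R, 0 < e & forall v, `|u - v| < e -> enlargement w v.
Proof.
move=> /dist_pt_ltP[a Aa]; rewrite /normH lte_fin => ua.
exists (radius 0 w / 2 - `|u - a|); first by rewrite subr_gt0.
move=> v uv; apply/dist_pt_ltP; exists a => //; rewrite /normH lte_fin.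
rewrite -(subrKA u) (le_lt_trans (ler_normD _ _)) //.
by move: uv; rewrite distrC ltrBrDr.
Qed.

Lemma flowD w k l u : G w -> flow (k + l) w u = flow k (sigma l%:Z w) (flow l w u).
Proof.
case: k => [//|k]; case: l => [|l] Gw; first by rewrite addn0 sigma0.
exact: psiD.
Qed.

Lemma psi0_flow w n u : G w -> (0 < n)%N -> psi 0 (sigma n%:Z w) (flow n w u) = flow n w u.
Proof. by case: n => // n Gw _; rewrite /= -psiD. Qed.

Lemma flow_psi0 w n u : G w -> (0 < n)%N -> flow n w (psi 0 w u) = flow n w u.
Proof. by case: n => // n Gw _; rewrite /= -[in RHS](addn0 n.+1) psiD // sigma0. Qed.

Lemma flow_cont n w : continuous (flow n w).
Proof. by case: n => [|n] u; [exact: cvg_id|exact: psi_cont]. Qed.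

Lemma pullback0 w : pullback 0 w = enlargement w.
Proof. by rewrite /pullback past0 image_id. Qed.

Lemma pullback_flow j n w : G w ->
  pullback (j + n) w = flow j (past j w) @` pullback n (past j w).
Proof.
move=> Gw.
have E u : flow (j + n) (past (j + n) w) u =
    flow j (past j w) (flow n (past n (past j w)) u).
  have -> : past (j + n) w = past n (past j w) by rewrite addnC pastD.
    by rewrite flowD ?pastK //; apply: Gpast; exact: Gpast.
apply/seteqP; split => [_ [u eu <-]|_ [_ [u eu <-] <-]].
  rewrite E; exists (flow n (past n (past j w)) u) => //; exists u => //.
  by rewrite -pastD addnC.
by rewrite -E; exists u => //; rewrite addnC pastD.
Qed.

Lemma pullbackS n w : G w ->
  pullback n.+1 w = psi 1 (past 1 w) @` pullback n (past 1 w).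
Proof. by move=> Gw; rewrite -add1n pullback_flow. Qed.

(** By stability, [psi 1] maps the [r]-neighbourhood of [A] into [A]. *)
Lemma pullback_sub n w : G w ->
  pullback n w `<=` closed_nbhd r (A w) /\ pullback n.+1 w `<=` A w.
Proof.
elim: n w => [|n IH] w Gw; last first.
  have sub : pullback n.+1 w `<=` A w by have [] := IH w Gw.
  split.
    by move=> u /sub /subset_enlargement /enlargement_sub_nbhd.
  rewrite pullbackS // => _ [u /(proj2 (IH _ (Gpast 1 Gw))) Au <-].
  rewrite -[in A _](pastK 1 w); apply: A_stable; first exact: Gpast.
  by move: Au => /subset_enlargement /enlargement_sub_nbhd.
rewrite pullbackS // !pullback0; split; first exact: enlargement_sub_nbhd.
move=> _ [u eu <-]; rewrite -[in A _](pastK 1 w).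
by apply: A_stable; [exact: Gpast|exact: enlargement_sub_nbhd].
Qed.

Lemma pullback_antitone m n w : G w -> (m <= n)%N ->
  pullback n w `<=` pullback m w.
Proof.
move=> + /subnKC <-; move: (n - m)%N => k; elim: m w => [|m IH] w Gw.
  rewrite add0n pullback0; case: k => [|k]; first by rewrite pullback0.
  by move=> u /(proj2 (pullback_sub k Gw)); exact: subset_enlargement.
rewrite addSn !pullbackS //; apply: image_subset.
by apply: IH; exact: Gpast.
Qed.

Lemma net_point_pullback n i w : admissible n i w -> pullback n w (net_point n i w).
Proof. by move=> ?; exists (h i). Qed.

(** [enlargement] is open and [flow] is continuous, so that the dense sequence
    suffices; this is why an open enlargement of [A] is used and not [A]. *)
Lemma pullback_approx n w u (e : R) : 0 < e -> pullback n w u ->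
  exists2 i, admissible n i w & `|u - net_point n i w| < e.
Proof.
move=> e0 [v ev <-]; have [e1 e10 ve1] := enlargement_open ev.
have /cvgr_dist_lt/(_ e e0) := @flow_cont n (past n w) v.
move=> /nbhs_ballP[e2 /= e20 ve2].
have [i ih] := h_dense v (e := Num.min e1 e2) ltac:(by rewrite lt_min e10 e20).
move: ih; rewrite lt_min => /andP[i1 i2].
exists i; first exact: ve1.
by apply: ve2; rewrite -ball_normE.
Qed.

(** One step of the dynamics sends balls of radius [radius n (past 1 w)] to sets
    of [V]-diameter of order [expR (- n%:R) * r]. To return to balls of radius
    [radius n.+1 w], the unit ball of [V] has to be covered at scale
    [(2 * expR 1 * kappa w)^-1], which multiplies the number of balls by
    [expR (f w)]. *)
Lemma pullback_covered n w : G w ->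
  covered (pullback n w) (radius n w) (budget n.+1 w).
Proof.
elim: n w => [|n IH] w Gw.
  have -> : budget 1 w = expR (f w).
    by rewrite /budget birkhoff_sumS /birkhoff_sum big_ord0 addr0.
  have [s [sx sA]] := A_covered Gw.
  exists s; split => //; rewrite pullback0 => u /dist_pt_ltP[a Aa].
  rewrite /normH lte_fin => ua; have [c cs ac] := sA _ Aa; exists c => //.
  rewrite -(subrKA a) (le_trans (ler_normD _ _)) //.
  move: ua ac; lra.
have -> : budget n.+2 w = budget n.+1 (past 1 w) * expR (f w).
  by rewrite /budget birkhoff_sumS addrC expRD.
have Gw1 := Gpast 1 Gw.
rewrite pullbackS //.
have k0 := kappa_gt0 w; have k10 := kappa_gt0 (past 1 w).
have lip u1 u2 : pullback n (past 1 w) u1 -> pullback n (past 1 w) u2 ->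
    exists2 v, iota v = psi 1 (past 1 w) u1 - psi 1 (past 1 w) u2 &
      `|v| <= kappa (past 1 w) * `|u1 - u2|.
  move=> /(proj1 (pullback_sub n Gw1)) u1A /(proj1 (pullback_sub n Gw1)) u2A.
  by apply: normV_le => //; exact: psi_smoothing.
have := covered_image (radius_gt0 n (past 1 w)) k10 lip (IH _ Gw1) (V_covered Gw).
apply: covered_mono => //.
have E : expR (- n.+1%:R) = expR (- n%:R) / expR 1 :> R.
  by rewrite -natr1 opprD expRD [expR (- 1)]expRN.
rewrite /radius E le_eqVlt; apply/orP; left; apply/eqP.
have e1 : expR 1 != 0 :> R by rewrite gt_eqF // expR_gt0.
by field; rewrite e1 !gt_eqF.
Qed.

Lemma exists_net n w : G w -> exists c, is_net n c w.
Proof.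
move=> Gw; have [|s [sx sal sP]] := @covered_select _ _ (admissible n ^~ w)
    (net_point n ^~ w) (radius n w) (budget n.+1 w).
  apply: covered_mono (pullback_covered n Gw) => // _ [i ai <-].
  exact: net_point_pullback.
exists (pickle s); rewrite /is_net /index_list pickleK /=; split => // i ai.
by have [j js ij] := sP i ai; exists j.
Qed.

Lemma exists_chosen_net n w : G w -> exists c, chosen_net n c w.
Proof.
move=> Gw; have [c cn] := exists_net n Gw.
have exb : exists c, `[< is_net n c w >] by exists c; exact/asboolP.
have [c' /asboolP c'n c'min] := ex_minnP exb.
exists c'; split => // c'' lt nn.
by have := c'min c''; rewrite leqNgt lt; move/(_ ltac:(exact/asboolP)).
Qed.

Lemma chosen_net_uniq n w c c' : chosen_net n c w -> chosen_net n c' w -> c = c'.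
Proof.
move=> [cn cmin] [c'n c'min].
by case: (ltngtP c c') => // lt; exfalso; [exact: c'min lt cn|exact: cmin lt c'n].
Qed.

Lemma selected_admissible n i w : selected n i w -> admissible n i w.
Proof. by move=> [c [[[cn _ _] _] ic]]; exact: cn. Qed.

(** A point of the pullback is first approximated within [radius n w] by the image
    of a point of the dense sequence, which is within twice that radius of the
    net. *)
Lemma selected_near n w u : G w -> pullback n w u ->
  exists2 i, selected n i w & `|u - net_point n i w| <= 3 * radius n w.
Proof.
move=> Gw nu; have [i ai ui] := pullback_approx (radius_gt0 n w) nu.
have [c [cn cmin]] := exists_chosen_net n Gw.
have [_ cP _] := cn; have [j [jc ij]] := cP i ai.
exists j; first by exists c.
rewrite -(subrKA (net_point n i w)) (le_trans (ler_normD _ _)) //.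
move: ui ij; lra.
Qed.

Lemma selected_covered n w (F : nat -> H) rho : 0 <= rho ->
  covered [set F i | i in [set i | selected n i w]] rho (budget n.+1 w).
Proof.
move=> rho0.
have [[c cn]|nc] := pselect (exists c, chosen_net n c w); last first.
  exists [::]; split; first exact: le_trans (budget_ge1 _ _).
  move=> u [i [c [cn _]] _].
  by case: nc; exists c.
have [[_ _ sz] _] := cn.
exists [seq F i | i <- index_list c]; split; first by rewrite size_map.
move=> _ [i [c' [c'n ic']] <-]; exists (F i); last by rewrite subrr normr0.
by apply: map_f; rewrite (chosen_net_uniq cn c'n).
Qed.

(** Net images with [j + k < n] are counted one by one: at most [n ^ 2] families,
    of at most [budget n.+1 w] points each; so is the family moved by [psi 0 w].
    All other images lie in [pullback n w], since pullbacks decrease. *)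
Lemma skeleton_covered n w : G w ->
  covered (skeleton w) (radius n w) (expR (2 * n.+1%:R) * budget n.+1 w).
Proof.
move=> Gw; have rho0 := ltW (radius_gt0 n w).
set x := budget n.+1 w.
have x0 : 0 <= x by exact: expR_ge0.
pose early j k := [set net_point (j + k) i w | i in
  [set i | selected k i (past j w) /\ is_true (j + k < n)%N]].
have cov1 j k : covered (early j k) (radius n w) x.
  have [jkn|jkn] := boolP (j + k < n)%N; last first.
    exists [::]; split; first exact: le_trans (budget_ge1 _ _).
    by move=> u [i [_ jkn']]; rewrite jkn' in jkn.
  apply: covered_mono (selected_covered k (past j w) (fun i => net_point (j + k) i w) rho0) => //.
    by move=> _ [i [si _] <-]; exists i.
  apply: (le_trans (budgetD _ _ _)); apply: leq_budget.
  by rewrite addnS ltnS ltnW.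
have covE := covered_bigcup (mulr_ge0 (ler0n _ n) x0) (n := n)
  (fun j _ => covered_bigcup x0 (n := n) (fun k _ => cov1 j k)).
have covP := covered_mono (@subset_refl _ _) (lexx _) (leq_budget w (isT : (0 < n.+1)%N))
  (selected_covered 0 w (psi 0 w \o h) rho0).
have := coveredU (coveredU covE covP) (pullback_covered n Gw).
apply: covered_mono => //; last first.
  rewrite -/x mulrA -[X in _ + X + _]mul1r -[X in _ + X]mul1r -!mulrDl ler_wpM2r //.
  (* n ^ 2 + 2 <= (n + 2) ^ 2 <= expR (n + 1) ^ 2 *)
  have e1 : n.+2%:R <= expR n.+1%:R :> R by rewrite -natr1 addrC expR_ge1Dx.
  rewrite expRM_natl.
  have : n.+2%:R ^+ 2 <= expR n.+1%:R ^+ 2 :> R by rewrite lerXn2r ?nnegrE ?expR_ge0.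
  apply: le_trans; rewrite -natrM -natrX !natr1 ler_nat; nia.
move=> u [[j [k [i [si ->]]]]|[i [si ->]]]; last by left; right; exists i.
have [jkn|njk] := ltnP (j + k) n.
  left; left; exists j; first by rewrite /= (leq_ltn_trans _ jkn) ?leq_addr.
  exists k; first by rewrite /= (leq_ltn_trans _ jkn) ?leq_addl.
  by exists i.
right; apply: (pullback_antitone Gw njk); apply: net_point_pullback.
by rewrite /admissible addnC pastD; exact: selected_admissible si.
Qed.

Lemma attractor_compact w : compact (attractor G w).
Proof.
rewrite /attractor; case: ifPn => [/set_mem Gw|_]; last exact: compact_set1.
apply: compact_of_covered; first exact: closed_closure.
move=> e e0.
have [n ne] : exists n, radius n w <= e.
  exists (Num.trunc (r / kappa w / e)).+1.
  rewrite /radius expRN mulrC ler_pdivrMr ?expR_gt0 // [e * _]mulrC -ler_pdivrMr //.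
  set t := r / kappa w / e.
  rewrite (le_trans (ltW (truncnS_gt t))) // (le_trans _ (expR_ge1Dx _)) //.
  by rewrite lerDr.
exists (expR (2 * n.+1%:R) * budget n.+1 w).
by apply: covered_mono (covered_closure (skeleton_covered n Gw)).
Qed.

Lemma attractor_dim w (c : R) : G w -> 0 <= c ->
  (forall n, birkhoff_sum (sigma (-1)) f n.+1 w <= n.+1%:R * c) ->
  (fractal_dim (attractor G w) <= (2 * (2 + c))%:E)%E.
Proof.
move=> Gw c0 fc; rewrite /attractor (mem_set Gw).
apply: (@fractal_dim_le _ _ _ (r / kappa w)).
- by rewrite divr_gt0 // kappa_gt0.
- by rewrite addr_ge0.
- move=> n; apply: covered_mono (covered_closure (skeleton_covered n Gw)) => //.
  by rewrite /budget -expRD ler_expR [(2 + c) * _]mulrDl lerD2l [c * _]mulrC.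
Qed.

Lemma attractor_invariant k w : G w ->
  psi k w @` attractor G w `<=` attractor G (sigma k%:Z w).
Proof.
move=> Gw; rewrite /attractor (mem_set Gw) (mem_set (Gsigma _ Gw)).
have sk : psi k w @` skeleton w `<=` skeleton (sigma k%:Z w).
  have pE j : past (k + j) (sigma k%:Z w) = past j w.
    by rewrite addnC pastD sigmaK.
  have npE l i : (0 < k)%N -> psi k w (net_point l i w) = net_point (k + l) i (sigma k%:Z w).
    move=> k0; rewrite /net_point pE flowD ?pastK; last exact: Gpast.
    by case: (k) k0.
  move=> _ [_ [[j [n [i [si ->]]]]|[i [si ->]]] <-].
    have [k0|k0] := posnP k; last first.
      left; exists (k + j)%N, n, i; rewrite pE; split => //.
      by rewrite npE // addnA.
    rewrite k0 sigma0; have [jn0|jn0] := posnP (j + n).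
      have [j0 n0] : j = 0%N /\ n = 0%N by lia.
      by move: si; rewrite j0 n0 /net_point past0 => si; right; exists i.
    left; exists j, n, i; split => //; rewrite /net_point.
    by rewrite -{1}(pastK (j + n) w) psi0_flow //; exact: Gpast.
  have [k0|k0] := posnP k.
    rewrite k0 sigma0; right; exists i; split => //.
    by have := @psiD w 0%N 0%N (h i) Gw; rewrite sigma0 => <-.
  left; exists k, 0%N, i; rewrite sigmaK; split => //.
  rewrite -npE // /net_point past0 /=.
  by case: (k) k0 => // k' _; exact: (@flow_psi0 w k'.+1).
move=> _ [u cu <-] B /psi_cont Bu.
have [v [sv Bv]] := cu _ Bu.
by exists (psi k w v); split => //; apply: sk; exists v.
Qed.

Section Attraction.
Variables (T : H -> R -> nat).
Hypothesis A_absorbing : absorbing_from sigma psi T A.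

Lemma absorbed_pullback c rho k w x : G w -> (T c rho <= k)%N ->
  closed_ball c rho x -> pullback (k - T c rho) (sigma k%:Z w) (psi k w x).
Proof.
move=> Gw; set t := T c rho => tk cx.
have At : A (sigma t%:Z w) (psi t w x).
  by apply: (A_absorbing (c := c) (rho := rho)) => //; exists x.
rewrite -{2 3}(subnK tk); case: (k - t)%N => [|j].
  by rewrite add0n pullback0; exact: subset_enlargement.
have E : past j.+1 (sigma (j.+1 + t)%:Z w) = sigma t%:Z w.
  by rewrite PoszD sigmaD sigmaK.
exists (psi t w x); rewrite E; first exact: subset_enlargement.
by rewrite psiD.
Qed.

Lemma attracts_H : attracts_from sigma psi normH T G (attractor G).
Proof.
exists 1; split => //.
exists (fun c rho => 3 * r * expR (T c rho)%:R) => w Gw c rho k Tk.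
apply: ge_ereal_sup => _ [_ [x cx <-] <-].
have pb := absorbed_pullback Gw Tk cx.
have Gk := Gsigma k%:Z Gw.
have [i si ui] := selected_near Gk pb.
apply: (@dist_pt_le _ _ _ _ (net_point (k - T c rho) i (sigma k%:Z w))).
  rewrite /attractor (mem_set Gk); apply: subset_closure; left.
  by exists 0%N, (k - T c rho)%N, i; rewrite past0.
rewrite /normH lee_fin (le_trans ui) // -!mulrA ler_pM2l //.
rewrite (le_trans (radius_le _ _)) // mulrC ler_pM2l // -expRD ler_expR.
by rewrite natrB // mulN1r; lra.
Qed.

(** One more application of [psi 1] converts closeness in [H] into closeness in
    [V]; its Lipschitz constant cancels the division by [kappa] in [radius]. *)
Lemma attracts_V :
  attracts_from sigma psi (normV iota) (fun c rho => (T c rho).+1) G (attractor G).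
Proof.
exists 1; split => //.
exists (fun c rho => 3 * r * expR (T c rho).+1%:R) => w Gw c rho [//|k] Tk.
apply: ge_ereal_sup => _ [_ [x cx <-] <-].
have pb := absorbed_pullback Gw Tk cx.
have Gk := Gsigma k%:Z Gw.
have [i si ui] := selected_near Gk pb.
set j := (k - T c rho)%N in pb si ui.
set w' := sigma k%:Z w in pb si ui Gk.
have E : sigma k.+1%:Z w = sigma 1 w' by rewrite -sigmaD -PoszD.
rewrite E -add1n psiD // -/w'.
apply: (@dist_pt_le _ _ _ _ (psi 1 w' (net_point j i w'))).
  apply: attractor_invariant => //; exists (net_point j i w') => //.
  rewrite /attractor (mem_set Gk); apply: subset_closure; left.
  by exists 0%N, j, i; rewrite past0.
apply: (le_trans (psi_smoothing Gk _ _)).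
- exact: (proj1 (pullback_sub j Gk)).
- apply: (proj1 (pullback_sub j Gk)); apply: net_point_pullback.
  exact: selected_admissible.
rewrite lee_fin; have k0 := kappa_gt0 w'.
rewrite (le_trans (ler_wpM2l (ltW k0) ui)) //.
have -> : kappa w' * (3 * radius j w') = 3 * r * expR (- j%:R).
  by rewrite /radius; field; rewrite gt_eqF.
rewrite -[leRHS]mulrA ler_pM2l ?mulr_gt0 // -expRD ler_expR /j natrB // mulN1r -!natr1.
lra.
Qed.

End Attraction.
End Pathwise.

(** ** Measurability of the construction *)

Section Measurability.
Hypothesis sigma_meas : forall k, measurable_fun [set: Omega] (sigma k).
Hypothesis psi_meas : measurable_fun [set: nat * Omega * borel H]
  (fun z => psi z.1.1 z.1.2 z.2 : borel H).
Hypothesis A_meas : forall u,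
  measurable_fun [set: Omega] (fun w => dist_pt normH u (A w)).
Hypothesis kappa_meas : measurable_fun [set: Omega] kappa.
Hypothesis kappa_ge1 : forall w, 1 <= kappa w.
Hypothesis f_meas : measurable_fun [set: Omega] f.
Hypothesis h_dense : forall x (e : R), 0 < e -> exists i, `|x - h i| < e.

Lemma measurable_set_past n (F : Omega -> Prop) : measurable [set w | F w] ->
  measurable [set w | F (past n w)].
Proof.
by move=> mF; rewrite -[X in measurable X]setTI; exact: (sigma_meas (- n%:Z) measurableT mF).
Qed.

Lemma measurable_radius n : measurable_fun [set: Omega] (radius n).
Proof.
apply: measurable_funM; first exact: measurable_cst.
apply: measurable_funM; first exact: measurable_cst.
rewrite (_ : (fun _ => _) = fun w => kappa w `^ (-1)).
  by apply: (measurableT_comp (measurable_powR (-1)) kappa_meas).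
by apply/funext => w; rewrite powR_inv1 // (le_trans ler01).
Qed.

Lemma measurable_psi n k u :
  measurable_fun [set: Omega] (fun w => psi n (past k w) u : borel H).
Proof.
apply: (measurableT_comp psi_meas (g := fun w => (n, past k w, u : borel H))).
apply: measurable_fun_pair; last exact: measurable_cst.
by apply: measurable_fun_pair; [exact: measurable_cst|exact: sigma_meas].
Qed.

Lemma measurable_net_point n i :
  measurable_fun [set: Omega] (fun w => net_point n i w : borel H).
Proof. by case: n => [|n]; [exact: measurable_cst|exact: measurable_psi]. Qed.

Lemma measurable_admissible n i : measurable [set w | admissible n i w].
Proof.
apply: (measurable_set_past n (F := fun w => enlargement w (h i))).
rewrite -[X in measurable X]setTI; apply: measurable_lte => //.
apply/measurable_EFinP; apply: measurable_funM; last exact: measurable_cst.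
exact: measurable_radius.
Qed.

(** Quantification over indices is countable, and choosing the least code only
    adds countably many negated conditions. *)
Lemma measurable_chosen_net n c : measurable [set w | chosen_net n c w].
Proof.
have mnet c' : measurable [set w | is_net n c' w].
  rewrite (_ : [set _ | _] =
    [set w | (forall i, i \in index_list c' -> admissible n i w) /\
      ((forall i, admissible n i w -> exists j, j \in index_list c' /\
        `|net_point n i w - net_point n j w| <= 2 * radius n w) /\
       (size (index_list c'))%:R <= budget n.+1 w)]); last first.
    by apply/seteqP; split => w; [move=> [] |move=> [? []]].
  apply: measurable_set_and; last apply: measurable_set_and.
  - apply: measurable_set_forall => i; apply: measurable_set_imply.
      exact: measurable_set_cst.
    exact: measurable_admissible.
  - apply: measurable_set_forall => i; apply: measurable_set_imply.
      exact: measurable_admissible.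
    apply: measurable_set_exists => j; apply: measurable_set_and.
      exact: measurable_set_cst.
    apply: measurable_set_ler.
      exact: measurable_dist h_dense (measurable_net_point n i) (measurable_net_point n j).
    by apply: measurable_funM; [exact: measurable_cst|exact: measurable_radius].
  - apply: measurable_set_ler => //; apply: measurableT_comp => //.
    exact: measurable_birkhoff_sum.
apply: measurable_set_and; first exact: mnet.
apply: measurable_set_forall => c'; apply: measurable_set_imply.
  exact: measurable_set_cst.
exact: measurable_set_not.
Qed.

Lemma measurable_selected n i : measurable [set w | selected n i w].
Proof.
apply: measurable_set_exists => c; apply: measurable_set_and.
  exact: measurable_chosen_net.
exact: measurable_set_cst.
Qed.

Lemma measurable_attractor_dist (G : set Omega) u : measurable G ->
  measurable_fun [set: Omega] (fun w => dist_pt normH u (attractor G w)).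
Proof.
move=> mG; apply: measurable_fun_esublevel => a.
pose near_skeleton w := (exists j n i, selected n i (past j w) /\
    `|net_point (j + n) i w - u| < a) \/
  (exists i, selected 0 i w /\ `|psi 0 (past 0 w) (h i) - u| < a).
rewrite (_ : [set _ | _] = G `&` [set w | near_skeleton w] `|`
    ~` G `&` [set _ | `|u| < a]); last first.
  apply/seteqP; split => w /=.
    rewrite /attractor; case: ifPn => [/set_mem Gw|/negP nGw].
      move=> /dist_pt_closure_ltP[v sv]; rewrite /normH lte_fin distrC => uv.
      left; split => //; move: sv => [[j [n [i [si vE]]]]|[i [si vE]]].
        by left; exists j, n, i; rewrite -vE.
      by right; exists i; rewrite past0 -vE.
    move=> /dist_pt_ltP[_ ->]; rewrite /normH subr0 lte_fin => ua.
    by right; split => // Gw; apply: nGw; exact: mem_set.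
  rewrite /attractor => -[[Gw sw]|[nGw ua]]; last first.
    rewrite (memNset nGw); apply/dist_pt_ltP; exists 0 => //.
    by rewrite /normH subr0 lte_fin.
  rewrite (mem_set Gw); apply/dist_pt_closure_ltP.
  move: sw => [[j [n [i [si vu]]]]|[i [si vu]]].
    exists (net_point (j + n) i w); first by left; exists j, n, i.
    by rewrite /normH distrC lte_fin.
  exists (psi 0 w (h i)); first by right; exists i.
  by rewrite past0 in vu; rewrite /normH distrC lte_fin.
apply: measurableU; apply: measurableI => //; last 2 first.
- exact: measurableC.
- exact: measurable_set_cst.
apply: measurableU.
  apply: measurable_set_exists => j; apply: measurable_set_exists => n.
  apply: measurable_set_exists => i; apply: measurable_set_and.
    exact: measurable_set_past (measurable_selected n i).
  apply: measurable_set_ltr => //; apply: measurable_dist_cst.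
  exact: measurable_net_point.
apply: measurable_set_exists => i; apply: measurable_set_and.
  exact: measurable_selected.
by apply: measurable_set_ltr => //; apply: measurable_dist_cst; exact: measurable_psi.
Qed.

End Measurability.
End Construction.

(** * The random exponential attractor *)

(** Remove the preimages of the exceptional null set under the whole group, which
    is countable. *)
Lemma ae_invariant_set {R : realType} (d : measure_display)
    (Omega : measurableType d) (P : probability Omega R)
    (sigma : int -> Omega -> Omega) (Q : Omega -> Prop) :
  measure_preserving_group P sigma -> {ae P, forall w, Q w} ->
  exists G : set Omega, [/\ measurable G, P G = 1%E,
    forall w k, G w -> G (sigma k w) & forall w, G w -> Q w].
Proof.
move=> [sigma0 sigmaD msigma Psigma] [N [mN PN QN]].
pose sg n := sigma (odflt 0 (unpickle n)).
have mE n : measurable (sg n @^-1` N).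
  by rewrite -[X in measurable X]setTI; exact: msigma.
exists [set w | forall k, ~ N (sigma k w)].
have GE : [set w | forall k, ~ N (sigma k w)] = ~` \bigcup_n (sg n @^-1` N).
  apply/seteqP; split => w /= nN.
    by move=> [n _ /nN].
  move=> k Nk; apply: nN; exists (pickle k) => //.
  by rewrite /= /sg pickleK.
have mU : measurable (\bigcup_n (sg n @^-1` N)) by exact: bigcupT_measurable.
split.
- by rewrite GE; exact: measurableC.
- rewrite GE probability_setC // (_ : P (\bigcup_n _) = 0%E) ?sube0 //.
  apply: measure_negligible => //; apply: negligible_bigcup => n.
  apply/(negligibleP _ (mE n)); exact: etrans (Psigma _ _ mN) PN.
- by move=> w k Gw l; rewrite -sigmaD.
- by move=> w /(_ 0); rewrite sigma0 => nN; apply: contrapT => nQ; exact/nN/QN.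
Qed.

Lemma powR_invN {R : realType} (x p : R) : 0 <= x -> x^-1 `^ (- p) = x `^ p.
Proof. by move=> x0; rewrite -powR_inv1 // -powRrM mulN1r opprK. Qed.

Theorem theorem3p2 (R : realType) (H : completeNormedModType R)
  (H_hilbert : hilbertian H) (H_separable : separable_space H)
  (d : measure_display) (Omega : measurableType d) (P : probability Omega R)
  (P_complete : measure_is_complete P)
  (sigma : int -> Omega -> Omega) (sigmaP : measure_preserving_group P sigma)
  (psi : nat -> Omega -> H -> H) (psi_rds : is_rds P sigma psi)
  (V : completeNormedModType R) (V_hilbert : hilbertian V)
  (iota : {linear V -> H}) (iota_compact : compact_embedding iota)
  (A : Omega -> set H) (A_random : random_compact_set A)
  (m r : R) (m_gt0 : 0 < m) (r_gt0 : 0 < r)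
  (T : H -> R -> nat) (A_absorbing : absorbing_from sigma psi T A)
  (A_stable : {ae P, forall omega,
     psi 1%N omega @` closed_nbhd r (A omega) `<=` A (sigma 1%:Z omega)})
  (K : Omega -> \bar R) (K_meas : measurable_fun [set: Omega] K)
  (K_fin : {ae P, forall omega, K omega \is a fin_num})
  (K_ge1 : {ae P, forall omega, (1 <= K omega)%E})
  (Km_L1 : P.-integrable [set: Omega] (fun omega => (K omega `^ m)%E))
  (psi_lipschitz : {ae P, forall omega, forall u1 u2 : H,
     closed_nbhd r (A omega) u1 -> closed_nbhd r (A omega) u2 ->
     (normV iota (psi 1%N omega u1 - psi 1%N omega u2)%R
       <= K omega * normH (u1 - u2)%R)%E})
  (C : R) (C_ : Omega -> \bar R) (C_meas : measurable_fun [set: Omega] C_)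
  (C_fin : {ae P, forall omega, C_ omega \is a fin_num})
  (CKm_L1 : P.-integrable [set: Omega]
     (fun omega => (C_ omega * K omega `^ m)%E))
  (V_entropy : forall e : R, 0 < e ->
     (entropy_embedding iota e <= (C * e `^ (- m))%R%:E)%E)
  (A_entropy : {ae P, forall omega, forall e : R, 0 < e ->
     (entropy (A omega) e <= C_ omega * (e `^ (- m))%R%:E)%E}) :
  exists M : Omega -> set H,
    random_exponential_attractor P sigma psi T M /\
    exists Omega_V : set Omega,
      [/\ measurable Omega_V, P Omega_V = 1%E &
          attracts_from sigma psi (normV iota) (fun c rho => (T c rho).+1)
            Omega_V M].
Proof.
have [sigma0 sigmaD msigma Psigma] := sigmaP.
have [psi_cont psi_meas psi_cocycle] := psi_rds.
have [iota_inj _ _] := iota_compact.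
have [_ A_meas] := A_random.
have [h h_dense] := exists_dense_sequence H_separable.
pose kappa w := Num.max 1 (fine (K w)).
have kappa_ge1 w : 1 <= kappa w by rewrite le_max lexx.
have kappa_ge0 w : 0 <= kappa w by exact: le_trans (kappa_ge1 w).
have kappa_meas : measurable_fun [set: Omega] kappa.
  apply: measurable_maxr; first exact: measurable_cst.
  exact: (measurableT_comp (fine_measurable measurableT) K_meas).
(* a and b are what the two entropy bounds give at the scales r / kappa / 2 and
   (2 * expR 1 * kappa)^-1, once the powers of kappa are factored out *)
pose a := (r / 2) `^ (- m); pose b := `|C| * (2 * expR 1) `^ m.
have a0 : 0 <= a by exact: powR_ge0.
have b0 : 0 <= b by rewrite mulr_ge0 ?powR_ge0.
pose f w := a * (`|fine (C_ w)| * kappa w `^ m) + b * kappa w `^ m.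
have f_ge0 w : 0 <= f w by rewrite addr_ge0 ?mulr_ge0 ?powR_ge0.
have kappam_meas : measurable_fun [set: Omega] (fun w => kappa w `^ m).
  exact: (measurableT_comp (measurable_powR m) kappa_meas).
have f_meas : measurable_fun [set: Omega] f.
  apply: measurable_funD; apply: measurable_funM; try exact: measurable_cst => //.
    apply: measurable_funM => //.
    apply: measurableT_comp => //.
    exact: (measurableT_comp (fine_measurable measurableT) C_meas).
  exact: kappam_meas.
have kappaE w : K w \is a fin_num -> (1 <= K w)%E -> K w = (kappa w)%:E.
  by move=> /fineK {1 2}<-; rewrite lee_fin /kappa => /max_idPr ->.
have f_int : (\int[P]_w (f w)%:E < +oo)%E.
  pose F w := (a%:E * `|C_ w * K w `^ m| + b%:E * `|K w `^ m|)%E.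
  have F_int : P.-integrable [set: Omega] F.
    apply: integrableD => //; apply: integrableZl => //.
      exact: (integrable_abse CKm_L1).
    exact: (integrable_abse Km_L1).
  rewrite (@ge0_ae_eq_integral _ _ _ P setT _ F) //.
  - exact: integrable_lty.
  - exact/measurable_EFinP.
  - by have /integrableP[] := F_int.
  - by move=> w _; rewrite lee_fin.
  - by move=> w _; rewrite /F adde_ge0 // mule_ge0 // lee_fin.
  apply: filterS3 K_fin K_ge1 C_fin => w Kfin K1 Cfin _.
  rewrite /F (kappaE _ Kfin K1) poweR_EFin -(fineK Cfin) -EFinM !abse_EFin.
  by rewrite normrM [`|kappa w `^ m|]ger0_norm ?powR_ge0.
pose Q w := [/\ psi 1%N w @` closed_nbhd r (A w) `<=` A (sigma 1%:Z w),
    forall u1 u2, closed_nbhd r (A w) u1 -> closed_nbhd r (A w) u2 ->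
      (normV iota (psi 1%N w u1 - psi 1%N w u2)%R
        <= (kappa w * `|u1 - u2|)%:E)%E,
    forall e : R, 0 < e ->
      (entropy (A w) e <= (`|fine (C_ w)| * e `^ (- m))%:E)%E,
    forall k l : nat, psi (k + l) w = psi k (sigma l%:Z w) \o psi l w &
    exists c, forall n, birkhoff_sum (sigma (-1)) f n w <= n%:R * c].
have aeQ : {ae P, forall w, Q w}.
  have growth := birkhoff_sum_linear_growth (msigma (-1)) (Psigma (-1)) f_meas
    f_ge0 f_int.
  apply: filterS3 (filterI A_stable psi_lipschitz)
    (filterI (filterI K_fin K_ge1) (filterI C_fin A_entropy))
    (filterI psi_cocycle growth) => w.
  move=> [stab lip] [[Kfin K1] [Cfin ent]] [coc gr]; split => //.
    by move=> u1 u2 /lip /[apply]; rewrite (kappaE _ Kfin K1).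
  move=> e e0; apply: (le_trans (ent e e0)).
  by rewrite -(fineK Cfin) -EFinM lee_fin ler_wpM2r ?powR_ge0 // ler_norm.
have [G [mG PG Gsigma GQ]] := ae_invariant_set sigmaP aeQ.
have psiD w k l u : G w -> psi (k + l)%N w u = psi k (sigma l%:Z w) (psi l w u).
  by move=> /GQ[_ _ _ -> _].
have stable w u : G w -> closed_nbhd r (A w) u -> A (sigma 1 w) (psi 1%N w u).
  by move=> /GQ[stab _ _ _ _] ?; apply: stab; exists u.
have smoothing w u1 u2 : G w -> closed_nbhd r (A w) u1 ->
    closed_nbhd r (A w) u2 ->
    (normV iota (psi 1%N w u1 - psi 1%N w u2)%R <= (kappa w * `|u1 - u2|)%:E)%E.
  by move=> /GQ[_ + _ _ _]; exact.
have A_cov w : G w -> covered (A w) (radius r kappa 0 w / 2) (expR (f w)).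
  move=> /GQ[_ _ ent _ _].
  have rad0 : 0 < radius r kappa 0 w / 2.
    by rewrite divr_gt0 // radius_gt0.
  apply: covered_mono (covered_by_entropy rad0 (ent _ rad0)) => //.
  rewrite ler_expR /f /radius oppr0 expR0 mul1r mulrAC.
  rewrite powRM ?invr_ge0 // ?divr_ge0 ?(ltW r_gt0) // powR_invN // -/a.
  by rewrite mulrCA lerDl mulr_ge0 ?powR_ge0.
have V_cov w : G w ->
    covered (iota @` closed_ball 0 1) (2 * expR 1 * kappa w)^-1 (expR (f w)).
  move=> _.
  have e0 : 0 <= 2 * expR 1 :> R by rewrite mulr_ge0 ?expR_ge0.
  have rad0 : 0 < (2 * expR 1 * kappa w)^-1.
    by rewrite invr_gt0 !mulr_gt0 ?expR_gt0 // (lt_le_trans ltr01).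
  apply: covered_mono (covered_by_entropy rad0 (V_entropy _ rad0)) => //.
  rewrite ler_expR powR_invN ?mulr_ge0 // powRM // mulrA.
  apply: (@le_trans _ _ (b * kappa w `^ m)).
    by rewrite ler_wpM2r ?powR_ge0 // ler_wpM2r ?powR_ge0 // ler_norm.
  by rewrite /f lerDr !mulr_ge0 ?powR_ge0.
exists (attractor sigma psi A r h kappa f G); split; last first.
  exists G; split => //.
  exact: (attracts_V sigma0 sigmaD Gsigma r_gt0 kappa_ge1 h_dense psi_cont
    psiD stable A_cov iota_inj smoothing V_cov A_absorbing).
split.
  split.
    move=> w; exact: (attractor_compact sigma0 sigmaD Gsigma r_gt0 kappa_ge1 f_ge0
      psiD stable A_cov iota_inj smoothing V_cov).
  move=> u; exact: (measurable_attractor_dist r sigma0 msigma psi_meas A_meas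
    kappa_meas kappa_ge1 f_meas h_dense u mG).
exists G; split => //.
- move=> w Gw k; exact: attractor_invariant.
- exact: (attracts_H sigma0 sigmaD Gsigma r_gt0 kappa_ge1 h_dense psi_cont
    psiD stable A_cov iota_inj smoothing V_cov A_absorbing).
(* the bound on the dimension is a random variable because the linear growth rate
   of the Birkhoff sums is a countable supremum *)
pose mean n w := (birkhoff_sum (sigma (-1)) f n.+1 w / n.+1%:R)%:E.
have mean_ge0 n w : (0 <= mean n w)%E.
  by rewrite lee_fin divr_ge0 // sumr_ge0.
have mean_le n w : (mean n w <= esups (mean ^~ w) 0%N)%E.
  by apply: ereal_sup_ubound; exists n.
have sup_ge0 w : (0 <= esups (mean ^~ w) 0%N)%E by exact: le_trans (mean_le 0%N w).
have sup_fin w : G w -> esups (mean ^~ w) 0%N \is a fin_num.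
  move=> /GQ[_ _ _ _ [c fc]]; rewrite ge0_fin_numE //.
  apply: (@le_lt_trans _ _ c%:E); last exact: ltry.
  apply: ge_ereal_sup => _ [n _ <-].
  by rewrite lee_fin ler_pdivrMr // mulrC.
exists (fun w => 2%:E * (2%:E + esups (mean ^~ w) 0%N))%E; split.
- apply: measurable_funeM; apply: emeasurable_funD => //.
  apply: measurable_fun_esups => n; apply/measurable_EFinP.
  apply: measurable_funM => //.
  exact: measurable_birkhoff_sum.
- by move=> w; rewrite mule_ge0 // adde_ge0.
- by move=> w Gw; rewrite fin_numM // fin_numD sup_fin.
move=> w Gw; rewrite -(fineK (sup_fin w Gw)) -EFinD -EFinM.
apply: (@attractor_dim _ _ _ _ sigma psi A r h kappa f sigma0 sigmaD G Gsigma
  r_gt0 kappa_ge1 f_ge0 psiD stable A_cov V iota) => //.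
  exact: fine_ge0.
move=> n; rewrite mulrC -ler_pdivrMr // -lee_fin fineK ?sup_fin //.
exact: mean_le.
Qed.
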